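(* For indeterminates $s,t$ and positive integers $n$ define $$\mathrm{SgnBDes}^D_n(s,t)=\sum_{\pi\in\mathfrak{D}_n}(-1)^{\mathrm{inv}_D(\pi)}s^{\mathrm{asc}_B(\pi)}t^{\mathrm{des}_B(\pi)},\qquad \mathrm{SgnBDes}^{B-D}_n(s,t)=\sum_{\pi\in\mathfrak{B}_n\setminus\mathfrak{D}_n}(-1)^{\mathrm{inv}_D(\pi)}s^{\mathrm{asc}_B(\pi)}t^{\mathrm{des}_B(\pi)}.$$ Then for positive integers $n\ge 2$ (with $\mathrm{SgnBDes}^D_0=1$, $\mathrm{SgnBDes}^{B-D}_0=0$ understood when $n=2$ if needed), $$\mathrm{SgnBDes}^D_n(s,t)=(s-t)^2\,\mathrm{SgnBDes}^D_{n-2}(s,t),\qquad \mathrm{SgnBDes}^{B-D}_n(s,t)=(s-t)^2\,\mathrm{SgnBDes}^{B-D}_{n-2}(s,t),$$ and consequently $$\mathrm{SgnBDes}^D_n(s,t)=\begin{cases}(s-t)^n & n\text{ even},\\ s(s-t)^{n-1} & n\text{ odd},\end{cases}\qquad \mathrm{SgnBDes}^{B-D}_n(s,t)=\begin{cases}0 & n\text{ even},\\ t(s-t)^{n-1} & n\text{ odd}.\end{cases}$$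
   Context: $\mathfrak{B}_n$ is the group of signed permutations of $\{\pm1,\dots,\pm n\}$, written $\pi=\pi_1\cdots\pi_n$ with $\pi_i=\pi(i)$. $\mathrm{negs}(\pi)=|\{i:\pi_i<0\}|$; $\mathfrak{D}_n=\{\pi\in\mathfrak{B}_n:\mathrm{negs}(\pi)\text{ even}\}$. For $\pi\in\mathfrak{B}_n$, $\mathrm{inv}_D(\pi)=|\{1\le i<j\le n:\pi_i>\pi_j\}|+|\{1\le i<j\le n:-\pi_i>\pi_j\}|$. With $\pi_0=0$, $\mathrm{des}_B(\pi)=|\{i\in\{0,\dots,n-1\}:\pi_i>\pi_{i+1}\}|$ and $\mathrm{asc}_B(\pi)=n-\mathrm{des}_B(\pi)$. *)

(* Defs.v *)
From HB Require Import structures.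
From mathcomp Require Import all_boot all_order all_fingroup all_algebra.
From mathcomp Require Import mpoly.

Set Implicit Arguments.
Unset Strict Implicit.
Unset Printing Implicit Defensive.

Import Order.TTheory GRing.Theory Num.Theory.
Local Open Scope ring_scope.

(* The set {±1, ..., ±n}: (k, b) stands for the integer (-1)^b (k + 1). *)
Definition spoint (n : nat) : finType := ('I_n * bool)%type.

Definition spoint_val n (x : spoint n) : int := (-1) ^+ x.2 * (x.1.+1)%:Z.

Definition spoint_opp n (x : spoint n) : spoint n := (x.1, ~~ x.2).

Definition signed_perm (n : nat) : {set {perm spoint n}} :=
  [set p : {perm spoint n} |
    [forall x, p (spoint_opp x) == spoint_opp (p x)]].

Lemma signed_perm_group_set n : group_set (signed_perm n).
Proof.
apply/group_setP; split=> [|p q].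
  by rewrite inE; apply/forallP=> x; rewrite !perm1.
rewrite !inE => /forallP hp /forallP hq; apply/forallP=> x.
by rewrite !permM (eqP (hp x)) (eqP (hq _)).
Qed.

Canonical signed_perm_group n := Group (signed_perm_group_set n).

(* Positions are 0-based: [sentry p i] is the letter usually written
   pi_(i+1) = pi(i+1). *)
Definition sentry n (p : {perm spoint n}) (i : 'I_n) : int :=
  spoint_val (p (i, false)).

(* The word pi_0 pi_1 ... pi_n with the convention pi_0 = 0. *)
Definition sentry0 n (p : {perm spoint n}) (i : 'I_n.+1) : int :=
  oapp (sentry p) 0 (unlift ord0 i).

Definition negs n (p : {perm spoint n}) : nat :=
  #|[set i : 'I_n | sentry p i < 0]|.

Definition signed_permD (n : nat) : {set {perm spoint n}} :=
  [set p in signed_perm n | ~~ odd (negs p)].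

Definition invD n (p : {perm spoint n}) : nat :=
  addn
    #|[set ij : 'I_n * 'I_n |
        (ij.1 < ij.2)%N & sentry p ij.1 > sentry p ij.2]|
    #|[set ij : 'I_n * 'I_n |
        (ij.1 < ij.2)%N & - sentry p ij.1 > sentry p ij.2]|.

(* As elements of 'I_n.+1, [widen_ord (leqnSn n) i] has value i and
   [lift ord0 i] has value i + 1. *)
Definition desB n (p : {perm spoint n}) : nat :=
  #|[set i : 'I_n |
      sentry0 p (widen_ord (leqnSn n) i) > sentry0 p (lift ord0 i)]|.

Definition ascB n (p : {perm spoint n}) : nat := (n - desB p)%N.

Definition s_var : {mpoly int[2]} := 'X_ord0.
Definition t_var : {mpoly int[2]} := 'X_ord_max.

Definition SgnBDesD (n : nat) : {mpoly int[2]} :=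
  \sum_(p in signed_permD n)
    (-1) ^+ invD p * s_var ^+ ascB p * t_var ^+ desB p.

Definition SgnBDesBD (n : nat) : {mpoly int[2]} :=
  \sum_(p in signed_perm n :\: signed_permD n)
    (-1) ^+ invD p * s_var ^+ ascB p * t_var ^+ desB p.

Lemma card_set_I0 (T : finType) (A : {set T}) : (T -> 'I_0) -> #|A| = 0%N.
Proof. by move=> f; apply: eq_card0 => x; case: (f x). Qed.

Lemma perm_spoint0 (p : {perm spoint 0}) : p = 1%g.
Proof. by apply/permP=> -[[]]. Qed.

Lemma mem_signed_permD0 (p : {perm spoint 0}) : p \in signed_permD 0.
Proof.
by rewrite (perm_spoint0 p) inE (group1 (signed_perm_group 0)) /negs card_set_I0.
Qed.

(* The defining sums already take the conventional values at n = 0. *)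
Lemma SgnBDesD0 : SgnBDesD 0 = 1.
Proof.
rewrite /SgnBDesD (big_pred1 1%g) => [|p].
  rewrite /ascB /invD /desB !card_set_I0 //; try by case.
  by rewrite !expr0 !mulr1.
by rewrite mem_signed_permD0 (perm_spoint0 p) /= eqxx.
Qed.

Lemma SgnBDesBD0 : SgnBDesBD 0 = 0.
Proof.
by rewrite /SgnBDesBD big_pred0 // => p; rewrite inE mem_signed_permD0.
Qed.

(* Main.v *)
Require Import Defs.
From HB Require Import structures.
From mathcomp Require Import all_boot all_order all_fingroup all_algebra.
From mathcomp Require Import mpoly zify ring.
Import Order.TTheory GRing.Theory Num.Theory.
Set Implicit Arguments.
Unset Strict Implicit.
Unset Printing Implicit Defensive.
Local Open Scope ring_scope.

(** Modulo 2, [invD p] is the number of inversions of |p|, so the sign of p is the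
    sign of the unsigned permutation |p|. Call block two adjacent letters of p
    equal to 1, 2 or -1, -2 in some order. If p has no block, exchanging the
    letters 1 and 2 (keeping signs) reverses the sign of p and keeps its descents
    and the parity of its number of negative letters, so these p cancel. If p has
    a block that is not at the start, exchanging 1 with -2 and 2 with -1 does the
    same. The remaining p are a block followed by a signed permutation of the
    letters of absolute value at least 3; the blocks 12, 21, -2-1, -1-2
    contribute s^2 - st - st + t^2 = (s - t)^2. *)

(** * Descents, inversions and weights of words *)

(** The argument [a] is the letter standing before [w]; at the start of a word it is pi_0 = 0. *)
Fixpoint wdes (a : int) (w : seq int) : nat :=
  if w is b :: w' then ((b < a)%R + wdes b w')%N else 0%N.

Fixpoint pairs (T : Type) (r : rel T) (w : seq T) : nat :=
  if w is a :: w' then (count (r a) w' + pairs r w')%N else 0%N.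

Definition word n (p : {perm spoint n}) : seq int :=
  [seq sentry p i | i <- enum 'I_n].

Lemma size_word n (p : {perm spoint n}) : size (word p) = n.
Proof. by rewrite size_map size_enum_ord. Qed.

Lemma count_enum n (T : Type) (f : 'I_n -> T) (a : pred T) :
  count a [seq f i | i <- enum 'I_n] = (\sum_(i < n) a (f i))%N.
Proof. by rewrite count_map -big_enum /= -sum1_count big_mkcond /=;
  apply: eq_bigr => i _; case: (a (f i)). Qed.

Lemma sum_wdes n (f : 'I_n.+1 -> int) :
  (\sum_(i < n) (f (lift ord0 i) < f (widen_ord (leqnSn n) i))%R)%N =
  wdes (f ord0) [seq f (lift ord0 i) | i <- enum 'I_n].
Proof.
elim: n f => [|n IHn] f; first by rewrite big_ord0 (size0nil (size_enum_ord 0)).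
rewrite big_ord_recl enum_ordSl /= -map_comp.
rewrite (_ : widen_ord _ ord0 = ord0); last exact: val_inj.
congr addn; rewrite -(IHn (fun i => f (lift ord0 i))).
apply: eq_bigr => i _.
by rewrite (_ : widen_ord _ (lift ord0 i) =
  lift ord0 (widen_ord (leqnSn n) i)); last exact: val_inj.
Qed.

Lemma card_pairs n (T : Type) (r : rel T) (f : 'I_n -> T) :
  #|[set ij : 'I_n * 'I_n | (ij.1 < ij.2)%N & r (f ij.1) (f ij.2)]| =
  pairs r [seq f i | i <- enum 'I_n].
Proof.
transitivity (\sum_(i < n) \sum_(j < n) ((i < j) && r (f i) (f j)))%N.
  rewrite pair_big /= -sum1dep_card big_mkcond /=.
  by apply: eq_bigr => -[i j] _ /=; case: (_ && _).
elim: n f => [|n IHn] f; first by rewrite big_ord0 (size0nil (size_enum_ord 0)).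
rewrite big_ord_recl enum_ordSl /= -map_comp; congr addn.
  by rewrite count_enum big_ord_recl.
rewrite -(IHn (fun i => f (lift ord0 i))).
by apply: eq_bigr => i _; rewrite big_ord_recl.
Qed.

Lemma desB_word n (p : {perm spoint n}) : desB p = wdes 0 (word p).
Proof.
rewrite /desB -sum1dep_card big_mkcond /=.
transitivity (\sum_(i < n) (sentry0 p (lift ord0 i) <
    sentry0 p (widen_ord (leqnSn n) i))%R)%N.
  by apply: eq_bigr => i _; case: (_ < _).
rewrite (sum_wdes (sentry0 p)) {1}/sentry0 unlift_none; congr wdes.
by apply: eq_map => i; rewrite /sentry0 liftK.
Qed.

Lemma negs_word n (p : {perm spoint n}) : negs p = count (< 0) (word p).
Proof.
rewrite /negs -sum1dep_card big_mkcond count_enum /=.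
by apply: eq_bigr => i _; case: (_ < _).
Qed.

Definition absz_word (w : seq int) : seq nat := [seq `|x|%N | x <- w].
Local Notation inv := (pairs gtn).

(* A pair with |a| < |b| counts 0 or 2 times, one with |a| > |b| once. *)
Lemma odd_pairs_absz (w : seq int) : uniq (absz_word w) ->
  odd (pairs (fun a b => b < a) w + pairs (fun a b => - a > b) w) =
  odd (inv (absz_word w)).
Proof.
elim: w => //= a w IHw /andP[aw /IHw].
rewrite !oddD => <-; set x := odd (pairs _ w); set y := odd (pairs _ w).
suff ->: odd (count (gtn `|a|%N) (absz_word w)) =
  odd (count (fun b => b < a) w) (+) odd (count (fun b => - a > b) w).
  by case: x; case: y; case: (odd _); case: (odd _).
elim: w aw {IHw x y} => //= b w IHw; rewrite inE negb_or => /andP[ab /IHw].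
rewrite !oddD => ->.
have ->: odd (`|b|%N < `|a|%N)%N = odd (b < a)%R (+) odd (b < - a)%R.
  by rewrite !oddb; lia.
set x := odd (b < a)%R; set y := odd (b < -a)%R.
by case: x; case: y; case: (odd _); case: (odd _).
Qed.

(** The summand of a signed permutation read off its word. The boolean exponent turns a parity
    change into a negation. *)
Definition weight (w : seq int) : {mpoly int[2]} :=
  (-1) ^+ odd (inv (absz_word w)) *
  s_var ^+ (size w - wdes 0 w) * t_var ^+ wdes 0 w.

Lemma weight_word n (p : {perm spoint n}) : uniq (absz_word (word p)) ->
  (-1) ^+ invD p * s_var ^+ ascB p * t_var ^+ desB p = weight (word p).
Proof.
move=> Up; rewrite /weight size_word -desB_word -odd_pairs_absz // signr_odd.
by rewrite /invD (card_pairs (fun a b => b < a)) (card_pairs (fun a b => - a > b)).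
Qed.

(** * The two swaps of letters and their effect on weights *)

(** Both sign-reversing involutions at once: they agree on absolute values, where each acts as
    [swap_abs]. Both fix 0, so they respect pi_0 = 0. *)
Definition swap_letter (b : bool) (x : int) : int :=
  if x == 1 then (if b then -2 else 2) else
  if x == 2 then (if b then -1 else 1) else
  if x == -1 then (if b then 2 else -2) else
  if x == -2 then (if b then 1 else -1) else x.

Definition swap_abs (k : nat) : nat :=
  (if k == 1 then 2 else if k == 2 then 1 else k)%N.

Definition block (x y : int) : bool :=
  [|| (x == 1) && (y == 2), (x == 2) && (y == 1),
      (x == -1) && (y == -2) | (x == -2) && (y == -1)].

(* The pairs of letters whose relative order [swap_letter b] may change. *)
Definition conflict (b : bool) (x y : int) : bool :=
  if b then [&& `|x| <= 2, `|y| <= 2 & ~~ ((0 < x) && (0 < y) || (x < 0) &&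
    (y < 0))]%R
  else block x y.

Definition noconflict b : rel int := fun x y => ~~ conflict b x y.

Ltac letter_cases x := case: (x =P 1) => ?; [subst x|case: (x =P 2) => ?;
  [subst x|case: (x =P -1) => ?; [subst x|case: (x =P -2) => ?; [subst x|]]]].

(** For [b = true], 1 < 2 goes to -2 < -1, so the order inside a block survives; for [b = false]
    only the two letters of a block change order. *)
Lemma swap_letter_lt b x y : noconflict b x y ->
  (swap_letter b y < swap_letter b x) = (y < x).
Proof.
rewrite /swap_letter /noconflict /conflict /block.
by case: b; letter_cases x; letter_cases y; lia.
Qed.

Lemma block_swap_letter b x y :
  block (swap_letter b x) (swap_letter b y) = block x y.
Proof. by rewrite /swap_letter /block; case: b; letter_cases x; letter_cases y;
  lia. Qed.

Lemma absz_swap_letter b x : `|swap_letter b x|%N = swap_abs `|x|.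
Proof.
rewrite /swap_letter /swap_abs; case: b; letter_cases x => //.
  by do 2?case: eqP => ?; lia.
by do 2?case: eqP => ?; lia.
Qed.

Lemma absz_word_swap_letter b w :
  absz_word (map (swap_letter b) w) = map swap_abs (absz_word w).
Proof. by rewrite /absz_word -!map_comp; apply: eq_map => x;
  apply: absz_swap_letter. Qed.

Lemma swap_letter_neg b x :
  (swap_letter b x < 0) = (x < 0) (+) (b && (`|x|%N \in [:: 1; 2]%N)).
Proof. by rewrite /swap_letter !inE; case: b; letter_cases x => //; lia. Qed.

Lemma wdes_swap_letter b a w : path (noconflict b) a w ->
  wdes (swap_letter b a) (map (swap_letter b) w) = wdes a w.
Proof. by elim: w a => //= c w IHw a /andP[/swap_letter_lt-> /IHw->]. Qed.

Lemma path_noblock_swap_letter b a w :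
  path (noconflict false) (swap_letter b a) (map (swap_letter b) w) =
    path (noconflict false) a w.
Proof. by elim: w a => //= c w IHw a;
  rewrite IHw /noconflict /= block_swap_letter. Qed.

(** The values 1 and 2 are consecutive, so exchanging them alters no comparison other than the one
    between 1 and 2. *)
Lemma inv_swap_abs_id l : ~~ ((1%N \in l) && (2%N \in l)) ->
  inv (map swap_abs l) = inv l.
Proof.
elim: l => //= a l IHl; rewrite !inE => al; rewrite IHl; last first.
  by apply: contra al => /andP[-> ->]; rewrite !orbT.
congr addn; rewrite count_map; apply: eq_in_count => c cl /=.
have ac : ~~ ((a == 1%N) && (c == 2%N) || (a == 2%N) && (c == 1%N)).
  by apply: contra al => /orP[]/andP[/eqP ea /eqP ec]; subst;
    rewrite cl ?eqxx ?orbT.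
move: ac; rewrite /swap_abs; case: (a =P 1%N) => ?; case: (a =P 2%N) => ?;
  case: (c =P 1%N) => ?; case: (c =P 2%N) => ?; lia.
Qed.

(** Exactly one pair of positions changes its order, the one holding 1 and 2. The induction runs
    down to the first of these letters; the tail after it lacks that letter and keeps its
    inversions. *)
Lemma odd_inv_swap_abs l : uniq l -> 1%N \in l -> 2%N \in l ->
  odd (inv (map swap_abs l)) = ~~ odd (inv l).
Proof.
elim: l => //= a l IHl /andP[al Ul]; rewrite !inE.
case: (a =P 1%N) => [a1 _ | a1].
  subst a; rewrite /= => l2; rewrite inv_swap_abs_id; last by rewrite (negPf al).
  rewrite !oddD count_map.
  (* The head becomes 2 and gains one inversion, with the former 2 of [l]. *)
  have ->: count (preim swap_abs (gtn (swap_abs 1))) l =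
    (count (gtn 1) l + count_mem 2%N l)%N.
    elim: l al {Ul l2 IHl} => //= c l IHl;
      rewrite inE negb_or => /andP[c1 /IHl-> /=].
    rewrite /swap_abs; case: (c =P 1%N) c1 => ?; case: (c =P 2%N) => ? /=; lia.
  by rewrite (count_uniq_mem _ Ul) l2 oddD /= addbT; case: odd; case: odd.
case: (a =P 2%N) => [a2 | a2].
  subst a => /= l1 _; rewrite inv_swap_abs_id; last by rewrite (negPf al) andbF.
  rewrite !oddD count_map.
  (* Conversely, a head 2 loses its inversion with the 1 of [l]. *)
  have ->: count (gtn 2%N) l =
    (count (preim swap_abs (gtn (swap_abs 2%N))) l + count_mem 1%N l)%N.
    elim: l al {Ul l1 IHl} => //= c l IHl;
      rewrite inE negb_or => /andP[c1 /IHl-> /=].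
    rewrite /swap_abs; case: (c =P 1%N) c1 => ?; case: (c =P 2%N) => ? /=; lia.
  by rewrite (count_uniq_mem _ Ul) l1 oddD /= addbT; case: odd; case: odd.
rewrite eq_sym (introF eqP a1) eq_sym (introF eqP a2) /= => l1 l2.
rewrite !oddD IHl // count_map.
rewrite (eq_count (a2 := gtn a)) ?addbN //.
by move=> c /=; rewrite /swap_abs; case: (a =P 1%N) => ?; case: (a =P 2%N) => ?;
  case: (c =P 1%N) => ?; case: (c =P 2%N) => ? /=; lia.
Qed.

Definition letters12 (w : seq int) :=
  [&& uniq (0%N :: absz_word w), 1%N \in absz_word w & 2%N \in absz_word w].

(** For [b = true] exactly two letters change sign, those of absolute value 1 and 2; for [b = false]
    none does. *)
Lemma odd_neg_swap_letter b w : letters12 w ->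
  odd (count (< 0) (map (swap_letter b) w)) = odd (count (< 0) w).
Proof.
case/and3P=> /= /andP[_ Uw] w1 w2.
have ->: odd (count (< 0) (map (swap_letter b) w)) =
  odd (count (< 0) w) (+) (b && odd (count (mem [:: 1; 2]%N) (absz_word w))).
  elim: w {Uw w1 w2} => [|x w IHw] /=; first by rewrite andbF.
  rewrite !oddD IHw swap_letter_neg !oddb.
  by case: (x < 0); case: b {IHw}; case: (_ \in _); case: (odd _); case: (odd _).
rewrite (eq_count (a2 := predU (pred1 1%N) (pred1 2%N))); last by move=> k;
  rewrite /= !inE.
have := count_predUI (pred1 1%N) (pred1 2%N) (absz_word w).
rewrite [count (predI _ _) _](eq_count (a2 := pred0)); last by case=> [|[|[]]].
by rewrite count_pred0 addn0 !count_uniq_mem // w1 w2 => ->; rewrite andbF addbF.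
Qed.

(** The inversion parity of the absolute values flips, while every comparison of adjacent letters of
    [0 :: w] is kept. *)
Lemma weight_swap_letter b w : letters12 w -> path (noconflict b) 0 w ->
  weight (map (swap_letter b) w) = - weight w.
Proof.
case/and3P=> /= /andP[_ Uw] w1 w2 ncw.
rewrite /weight absz_word_swap_letter odd_inv_swap_abs // size_map (_ :
  0 = swap_letter b 0); last by case: b {ncw}.
by rewrite wdes_swap_letter // signrN !mulNr.
Qed.

(** * The position of a block in a word *)

(** The default 0 lies in no block, so words with fewer than two letters give [false]. *)
Definition starts_block (w : seq int) : bool := block (nth 0 w 0) (nth 0 w 1).

Lemma starts_block_swap_letter b w :
  starts_block (map (swap_letter b) w) = starts_block w.
Proof.
rewrite /starts_block; case: w => [|x [|y w]] //=; last exact: block_swap_letter.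
by rewrite -[RHS](block_swap_letter b); case: b.
Qed.

Lemma not_pathP (T : Type) (r : rel T) a w : ~~ path r a w ->
  exists w1 x y w2, a :: w = w1 ++ x :: y :: w2 /\ ~~ r x y.
Proof.
elim: w a => //= c w IHw a; case: (boolP (r a c)) => [_ /= /IHw|nrac _]; last first.
  by exists [::], a, c, w.
by case=> w1 [x [y [w2 [-> ?]]]]; exists (a :: w1), x, y, w2.
Qed.

Lemma noconflict_big b x y : (2 < `|x|) || (2 < `|y|) -> noconflict b x y.
Proof. by rewrite /noconflict /conflict /block; case: b; lia. Qed.

Lemma path_noconflict_big b a w : all (fun x => 2 < `|x|) w ->
  path (noconflict b) a w.
Proof. by elim: w a => //= c w IHw a /andP[c2 /IHw->];
  rewrite noconflict_big ?c2 ?orbT. Qed.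

(* The letters of absolute value at most 2 of 0 :: w are 0 and the two letters of
   the block, and 0 is not next to the block. *)
Lemma inner_block w : uniq (0%N :: absz_word w) ->
  ~~ path (noconflict false) 0 w -> ~~ starts_block w -> path (noconflict true) 0 w.
Proof.
move=> Uw npw; have [w0 [x [y [w2 [Ew bxy]]]]] := not_pathP npw.
(* An empty prefix would make the initial 0 a letter of the block. *)
case: w0 Ew => [|a w1] /= [E0 Ew].
  by move: bxy; rewrite -E0 /noconflict /conflict /block; lia.
move: bxy; rewrite negbK => bxy; move: Uw; rewrite {}Ew => Uw.
have big : all (fun z => 2 < `|z|) (w1 ++ w2).
  apply/allP => z zw.
  have {}Uw : uniq ([:: 0; `|x|; `|y|]%N ++ absz_word (w1 ++ w2)).
    rewrite -(perm_uniq (s1 := 0%N :: absz_word (w1 ++ [:: x, y & w2]))) //.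
    by rewrite perm_cons /absz_word !map_cat perm_sym (perm_catCA [:: `|x|;
      `|y|]%N).
  have zw' : `|z|%N \in absz_word (w1 ++ w2) by apply: map_f.
  move: Uw; rewrite cat_uniq => /and3P[_ /hasPn/(_ _ zw') /=].
  by rewrite !inE; move: bxy; rewrite /conflict /block; lia.
rewrite all_cat in big; case/andP: big => big1 big2.
(* If [w1] is empty, the block starts the word; otherwise the large letter [c] comes right after
   0. *)
case: w1 big1 {Uw} => [|c w1] /=;
  first by rewrite /starts_block -[block _ _]/(conflict false x y) bxy.
move=> /andP[c2 big1] _; rewrite cat_path /=; apply/and5P; split.
- by rewrite noconflict_big // c2 orbT.
- exact: path_noconflict_big.
- have /allP/(_ _ (mem_last c w1)) lbig : all (fun z => 2 < `|z|) (c :: w1).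
    by rewrite /= c2.
  by rewrite noconflict_big // lbig.
- by move: bxy; rewrite /noconflict /conflict /block; lia.
exact: path_noconflict_big.
Qed.

(** * Words of signed permutations *)

Lemma absz_spoint_val n (x : spoint n) : `|spoint_val x|%N = x.1.+1.
Proof. by rewrite /spoint_val abszM abszX exp1n mul1n. Qed.

Lemma spoint_val_sign n (k : 'I_n) (b : bool) :
  spoint_val (k, b) = if b then - (k.+1%:Z) else k.+1%:Z.
Proof. by rewrite /spoint_val /=; case: b;
  rewrite ?expr0 ?mul1r // expr1 mulN1r. Qed.

Lemma signed_permP n (p : {perm spoint n}) :
  reflect (forall x, p (spoint_opp x) = spoint_opp (p x)) (p \in signed_perm n).
Proof. by rewrite inE; apply: (iffP forallP) => h x; apply/eqP. Qed.

(** If p(i) and p(j) have the same absolute value, then p(i) equals p(j) or -p(j) = p(-j);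
    injectivity gives i = j either way. *)
Lemma absz_word_uniq n (p : {perm spoint n}) : p \in signed_perm n ->
  uniq (0%N :: absz_word (word p)).
Proof.
move=> /signed_permP Bp; rewrite /absz_word /word -map_comp /=; apply/andP; split.
  by apply/mapP => -[i _ /=]; rewrite /sentry absz_spoint_val.
rewrite map_inj_uniq ?enum_uniq // => i j /=.
rewrite /sentry !absz_spoint_val => -[/val_inj].
case: ((p (i, false)).2 =P (p (j, false)).2) => E1 E2.
  have : p (i, false) = p (j, false)
    by case: (p _) (p _) E1 E2 => [a b] [c d] /= -> ->.
  by move/perm_inj => [].
have : p (i, false) = p (spoint_opp (j, false)).
  rewrite Bp; case: (p _) (p _) E1 E2 => [a b] [c d] /= bd ->; congr pair.
  by case: b d bd => [] [].
by move/perm_inj => [].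
Qed.

Lemma absz_word_mem n (p : {perm spoint n}) (k : 'I_n) : p \in signed_perm n ->
  k.+1 \in absz_word (word p).
Proof.
move=> /signed_permP Bp; rewrite /absz_word /word -map_comp.
have [[i b] Ei] : exists x, p x = (k, false) by exists ((p^-1)%g (k, false));
  rewrite permKV.
apply/mapP; exists i; rewrite ?mem_enum //= /sentry absz_spoint_val.
case: b Ei => [Ei|->//]; have := Bp (i, true); rewrite /spoint_opp /= => ->.
by rewrite Ei.
Qed.

Lemma letters12_word m (p : {perm spoint m.+2}) : p \in signed_perm m.+2 ->
  letters12 (word p).
Proof.
move=> Bp; rewrite /letters12 absz_word_uniq //.
by rewrite (absz_word_mem ord0 Bp) (absz_word_mem (lift ord0 ord0) Bp).
Qed.

(** * The swaps as signed permutations *)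

Definition swap_point (b : bool) m (x : spoint m.+2) : spoint m.+2 :=
  (tperm ord0 (lift ord0 ord0) x.1, if (x.1 < 2)%N then x.2 (+) b else x.2).

Lemma swap_point_cases b m (x : spoint m.+2) :
  [\/ x.1 = ord0 /\ swap_point b x = (lift ord0 ord0, x.2 (+) b),
      x.1 = lift ord0 ord0 /\ swap_point b x = (ord0, x.2 (+) b)
    | (1 < x.1)%N /\ swap_point b x = x].
Proof.
case: x => -[[|[|k]] lt_k] c; rewrite /swap_point /=.
- have -> : Ordinal lt_k = ord0 by apply: val_inj.
  by rewrite tpermL; constructor 1.
- have -> : Ordinal lt_k = lift ord0 ord0 by apply: val_inj.
  by rewrite tpermR; constructor 2.
by rewrite tpermD //; constructor 3.
Qed.

Lemma swap_pointK b m : involutive (@swap_point b m).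
Proof.
move=> x; case: (swap_point_cases b x) => [] [x1 E]; rewrite E //.
- by rewrite /swap_point /= tpermR -addbA addbb addbF -x1; case: x {x1 E}.
- by rewrite /swap_point /= tpermL -addbA addbb addbF -x1; case: x {x1 E}.
Qed.

Definition swap_perm b m : {perm spoint m.+2} := perm (inv_inj (@swap_pointK b m)).

Lemma swap_perm_signed b m : swap_perm b m \in signed_perm m.+2.
Proof.
apply/signed_permP => x; rewrite !permE /swap_point /spoint_opp /=; congr pair.
by case: ifP => // _; rewrite addNb.
Qed.

Lemma spoint_val_swap_perm b m x :
  spoint_val (swap_perm b m x) = swap_letter b (spoint_val x).
Proof.
rewrite permE; case: (swap_point_cases b x) => [] [x1 ->]; case: x x1 => k c /= k1.
- by rewrite k1 !spoint_val_sign; case: b; case: c.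
- by rewrite k1 !spoint_val_sign; case: b; case: c.
rewrite /swap_letter spoint_val_sign.
by case: c; do 4 (rewrite [_ == _](_ : _ = false); last by lia).
Qed.

(** In a product of permutations the left factor acts first, so multiplying on the right changes
    letters and not positions. *)
Lemma word_swap_perm b m (p : {perm spoint m.+2}) :
  word (p * swap_perm b m)%g = map (swap_letter b) (word p).
Proof.
rewrite /word -map_comp; apply: eq_map => i /=.
by rewrite /sentry permM spoint_val_swap_perm.
Qed.

(** * Cancellation down to words starting with a block *)

(** The boolean treats $\mathfrak{D}_n$ ([false]) and its complement ([true]) together, as both obey
    the same recurrence. *)
Definition parity_class n b (p : {perm spoint n}) : bool :=
  (p \in signed_perm n) && (odd (negs p) == b).

Definition parity_sum n b : {mpoly int[2]} :=
  \sum_(p : {perm spoint n} | parity_class b p) weight (word p).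

Lemma SgnBDesD_parity n : SgnBDesD n = parity_sum n false.
Proof.
apply: eq_big => [p|p]; first by rewrite inE /parity_class eqbF_neg.
by rewrite inE => /andP[/absz_word_uniq/andP[_ ?] _]; rewrite weight_word.
Qed.

Lemma SgnBDesBD_parity n : SgnBDesBD n = parity_sum n true.
Proof.
apply: eq_big => [p|p].
  by rewrite !inE /parity_class eqb_id inE; case: [forall x, _]; case: (odd _).
by rewrite inE => /andP[_ /absz_word_uniq/andP[_ ?]]; rewrite weight_word.
Qed.

Lemma parity_class_swap_perm b c m (p : {perm spoint m.+2}) :
  parity_class b (p * swap_perm c m)%g = parity_class b p.
Proof.
rewrite /parity_class (groupMr (G := signed_perm_group _)) ?swap_perm_signed //.
have [Bp|//] := boolP (p \in _).
by rewrite !negs_word word_swap_perm odd_neg_swap_letter // letters12_word.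
Qed.

Lemma sum_swap_perm_eq0 c m (Q : pred {perm spoint m.+2}) :
  (forall p, Q (p * swap_perm c m)%g = Q p) ->
  (forall p, Q p -> p \in signed_perm m.+2 /\ path (noconflict c) 0 (word p)) ->
  \sum_(p | Q p) weight (word p) = 0.
Proof.
move=> QM QP; set S := \sum_(p | _) _.
have: S = - S.
  rewrite {1}/S (reindex_inj (mulIg (swap_perm c m))) /= -sumrN.
  apply: eq_big => // p; rewrite QM => /QP[Bp ncp].
  by rewrite word_swap_perm weight_swap_letter // letters12_word.
(* The coefficients are integers, so S = -S forces S = 0. *)
move=> /mpolyP SN; apply/mpolyP => k; have := SN k; rewrite mcoeffN mcoeff0; lia.
Qed.

Definition starts_with (x y : int) (w : seq int) : bool :=
  (nth 0 w 0 == x) && (nth 0 w 1 == y).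

Definition starts_sum m b (x y : int) : {mpoly int[2]} :=
  \sum_(p : {perm spoint m.+2} | parity_class b p &&
    starts_with x y (word p)) weight (word p).

Lemma parity_sum_starts m b : parity_sum m.+2 b =
  starts_sum m b 1 2 + starts_sum m b 2 1 + starts_sum m b (-1) (-2) +
    starts_sum m b (-2) (-1).
Proof.
(* Words without a block cancel under the swap with [b = false]. *)
rewrite /parity_sum (bigID (fun p => path (noconflict false) 0 (word p))) /=.
rewrite (sum_swap_perm_eq0 (c := false)) ?add0r; first last.
- by move=> p /andP[/andP[]].
- move=> p; rewrite parity_class_swap_perm word_swap_perm.
  by rewrite (_ : 0 = swap_letter false 0) // path_noblock_swap_letter.
(* Words whose block is not at the start cancel under the swap with [b = true]. *)
rewrite (bigID (fun p => starts_block (word p))) /= addrC.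
rewrite (sum_swap_perm_eq0 (c := true)) ?add0r; first last.
- move=> p /andP[/andP[/andP[Bp _] ncp] sp]; split=> //.
  by rewrite inner_block // absz_word_uniq.
- move=> p; rewrite parity_class_swap_perm word_swap_perm starts_block_swap_letter.
  by rewrite (_ : 0 = swap_letter true 0) // path_noblock_swap_letter.
rewrite /starts_sum !(big_mkcond (fun p => _ && _)) -!big_split /=.
apply: eq_bigr => p _; case: (parity_class b p); rewrite /= ?addr0 //.
rewrite /starts_with /starts_block.
case: (word p) => [|x [|y w]] /=; rewrite ?andbF ?addr0 //.
(* A block at the start already breaks the path condition, and it is exactly one of the four ordered
   pairs. *)
rewrite /noconflict /=; case: (boolP (block x y)) => bxy.
  by case/or4P: bxy => /andP[/eqP-> /eqP->]; rewrite /= ?addr0 ?add0r.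
rewrite andbF; move: bxy; rewrite /block !negb_or => /and4P[].
by do 4 move=> /negPf->; rewrite !addr0.
Qed.

(** * Prefixing a block to a smaller signed permutation *)

(** The order-preserving renaming of ±1, ..., ±m as ±3, ..., ±(m+2). *)
Definition shift_letter (x : int) : int := x + 2 * Num.sg x.

(** The word 1 2 followed by the shifted word of [q]: ±1 and ±2 are fixed, and [q] acts on the other
    points with indices moved by 2. *)
Definition extf m (q : {perm spoint m}) (x : spoint m.+2) : spoint m.+2 :=
  match @split 2 m x.1 with
  | inl _ => x
  | inr k => (rshift 2 (q (k, x.2)).1, (q (k, x.2)).2)
  end.

Lemma extfK m (q : {perm spoint m}) : cancel (extf q) (extf q^-1%g).
Proof.
case=> i b; rewrite /extf /=; case: (@splitP 2 m i) => [j ij|k ik] /=.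
  by case: splitP => // k; have := ltn_ord j; lia.
rewrite (unsplitK (inr _)) -surjective_pairing permK /=; congr pair.
exact/val_inj.
Qed.

Definition ext m (q : {perm spoint m}) :
  {perm spoint m.+2} := perm (can_inj (@extfK m q)).

Lemma extE m (q : {perm spoint m}) (k : 'I_m) b :
  ext q (rshift 2 k, b) = (rshift 2 (q (k, b)).1, (q (k, b)).2).
Proof. by rewrite permE /extf /= (unsplitK (inr _)). Qed.

Lemma ext_fix m (q : {perm spoint m}) (x : spoint m.+2) : (x.1 < 2)%N ->
  ext q x = x.
Proof. by rewrite permE /extf; case: splitP => // k ->. Qed.

Lemma spoint2P m (x : spoint m.+2) :
  (x.1 < 2)%N \/ exists k b, x = (rshift 2 k, b) :> spoint (2 + m).
Proof.
case: x => i b /=; case: (@splitP 2 m i) => [j ij|k ik].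
  by left; have := ltn_ord j; rewrite -ij.
by right; exists k, b; congr pair; apply: val_inj.
Qed.

Lemma ext_signed m (q : {perm spoint m}) :
  (ext q \in signed_perm m.+2) = (q \in signed_perm m).
Proof.
apply/signed_permP/signed_permP => [Bq [k b]|Bq x].
  have := Bq (rshift 2 k, b); rewrite {1}/spoint_opp !extE /= -/(spoint_opp (k, b)).
  case: (q _) (q _) => [i c] [i' c']; rewrite /spoint_opp /= => -[ii ->].
  by congr pair; apply: val_inj.
have [x2|[k [b ->]]] := spoint2P x; first by rewrite !ext_fix.
by rewrite {1}/spoint_opp !extE /= -/(spoint_opp (k, b)) Bq.
Qed.

Lemma spoint_val_inj n : injective (@spoint_val n).
Proof.
move=> [i b] [j c]; rewrite !spoint_val_sign => E.
by congr pair; [apply: val_inj|]; move: E; case: b; case: c => /=; lia.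
Qed.

(** Such a [p] fixes ±1 and ±2, so it permutes the remaining points; [q] is that restriction. *)
Lemma ext_surj m (p : {perm spoint m.+2}) : p \in signed_perm m.+2 ->
  starts_with 1 2 (word p) -> exists q, ext q = p.
Proof.
move=> /signed_permP Bp;
  rewrite /starts_with /word !enum_ordSl /= => /andP[/eqP p0 /eqP p1].
have fix_p (x : spoint m.+2) : (x.1 < 2)%N -> p x = x.
  suff H (i : 'I_m.+2) : (i < 2)%N -> p (i, false) = (i, false).
    case: x => i [] /= i2; last exact: H.
    by have := Bp (i, false); rewrite /spoint_opp /= H.
  case: i => -[|[|//]] lt_i _; apply: spoint_val_inj.
    by rewrite (_ : Ordinal lt_i = ord0) ?[LHS]p0 //; apply: val_inj.
  by rewrite (_ : Ordinal lt_i = lift ord0 ord0) ?[LHS]p1 //; apply: val_inj.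
have shift_p (x : spoint m) : exists y :
  spoint m, p (rshift 2 x.1, x.2) = (rshift 2 y.1, y.2).
  have [y2|[k [b E]]] := spoint2P (p (rshift 2 x.1, x.2)); last by exists (k, b).
  (* An image among ±1, ±2 is itself a fixed point, so by injectivity it would equal its preimage,
     whose index is at least 2. *)
  by have /perm_inj E := fix_p _ y2; move: y2; rewrite E.
have [f fE] := fin_all_exists shift_p.
have f_inj : injective f.
  move=> [i b] [j c] E;
    have: p (rshift 2 i, b) =
      p (rshift 2 j, c) by rewrite (fE (i, b)) (fE (j, c)) E.
  by move/perm_inj => -[ij ->]; congr pair; apply: val_inj.
exists (perm f_inj); apply/permP => x.
have [x2|[k [b ->]]] := spoint2P x; first by rewrite ext_fix // fix_p.
by rewrite extE permE (fE (k, b)).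
Qed.

Lemma ext_starts m (q : {perm spoint m}) : starts_with 1 2 (word (ext q)).
Proof.
rewrite /starts_with /word !enum_ordSl /= /sentry !ext_fix //.
Qed.

Lemma ext_inj m : injective (@ext m).
Proof.
move=> q r /permP qr; apply/permP => -[k b].
have := qr (rshift 2 k, b); rewrite !extE.
by case: (q _) (r _) => [i c] [j d] [/= ij ->]; congr pair; apply: val_inj.
Qed.

Lemma word_ext m (q : {perm spoint m}) :
  word (ext q) = [:: 1, 2 & map shift_letter (word q)].
Proof.
rewrite /word !enum_ordSl /= {1 2}/sentry !ext_fix //; congr [:: _, _ & _].
rewrite -!map_comp; apply: eq_map => k /=; rewrite /sentry.
rewrite (_ : lift ord0 (lift ord0 k) = rshift 2 k); last exact: val_inj.
rewrite extE; case: (q _) => i b; rewrite !spoint_val_sign /shift_letter /=.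
by case: b; lia.
Qed.

Lemma shift_letter_neg x : (shift_letter x < 0) = (x < 0).
Proof. by rewrite /shift_letter; case: sgrP => ?; lia. Qed.

(** The first shifted letter has absolute value at least 3, so it compares with [a] by its sign
    alone, as it would with 0. *)
Lemma wdes_shift_letter a w : 0 \notin w -> (`|a| <= 2)%R ->
  wdes a (map shift_letter w) = wdes 0 w.
Proof.
case: w => //= x w; rewrite inE negb_or => /andP[x0 _] a2; congr addn.
  by rewrite /shift_letter; congr nat_of_bool; case: sgrP x0 => ?; lia.
elim: w x {x0} => //= y w IHw x; rewrite IHw; congr (nat_of_bool _ + _)%N.
by rewrite /shift_letter; case: (sgrP x) => ?; case: (sgrP y) => ?; lia.
Qed.

Lemma inv_addn c l : inv (map (addn c) l) = inv l.
Proof.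
elim: l => //= a l ->; congr addn; rewrite count_map.
by apply: eq_count => b /=; rewrite ltn_add2l.
Qed.

Lemma count_gtn_addn a c l : (a <= c)%N -> count (gtn a) (map (addn c) l) = 0%N.
Proof.
move=> ac; rewrite count_map (eq_count (a2 := pred0)) ?count_pred0 // => b /=.
by lia.
Qed.

Lemma wdes_size a w : (wdes a w <= size w)%N.
Proof. by elim: w a => //= b w IHw a; have := IHw b; case: (b < a) => /=; lia. Qed.

Lemma absz_word_shift_letter w : 0 \notin w ->
  absz_word (map shift_letter w) = map (addn 2) (absz_word w).
Proof.
move=> w0; rewrite /absz_word -!map_comp; apply/eq_in_map => x xw /=.
have x0 : x != 0 by apply: contraNneq w0 => <-.
by rewrite /shift_letter; case: sgrP x0 => ?; lia.
Qed.

(** No inversion of absolute values joins the block to the tail, and the tail sees [y] as it would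
    see pi_0 = 0, so the weight factors. *)
Lemma weight_block (x y : int) w : 0 \notin w -> (`|x| <= 2)%R -> (`|y| <= 2)%R ->
  weight [:: x, y & map shift_letter w] =
  (-1) ^+ (`|y| < `|x|)%N * s_var ^+ (2 - ((x < 0)%R + (y < x)%R))
    * t_var ^+ ((x < 0)%R + (y < x)%R) * weight w.
Proof.
move=> w0 x2 y2; rewrite /weight /= absz_word_shift_letter // !count_gtn_addn;
  try lia.
rewrite inv_addn !addn0 add0n wdes_shift_letter // oddD oddb signr_addb size_map.
have := wdes_size 0 w; set d := wdes 0 w; set z := size w; set e := inv _ => dz.
rewrite addnA; set c := ((x < 0)%R + _)%N; have c2 : (c <= 2)%N by rewrite /c;
  case: (x < 0); case: (y < x).
(* The truncated subtractions split because c <= 2 and d <= z. *)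
rewrite (_ : (z.+2 - (c + d) = (2 - c) + (z - d))%N); last by lia.
rewrite !exprD; ring.
Qed.

Lemma word_neq0 n (p : {perm spoint n}) : 0 \notin word p.
Proof.
apply/mapP => -[i _]; rewrite /sentry => /(congr1 absz).
by rewrite absz_spoint_val.
Qed.

Lemma parity_class_ext m b (q : {perm spoint m}) :
  parity_class b (ext q) = parity_class b q.
Proof.
rewrite /parity_class ext_signed !negs_word word_ext /= count_map.
by rewrite (eq_count (a2 := < 0)) //; apply: shift_letter_neg.
Qed.

(** * The recurrence *)

(** Right multiplication by [g], which acts on letters as [h], turns words starting with 1 2 into
    those starting with [x y]; [ext] then parametrizes the former by rank m. *)
Lemma sum_starts m b (g : {perm spoint m.+2}) (x y : int) (h : int -> int) :
  (forall p, parity_class b (p * g)%g = parity_class b p) ->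
  (forall p, word (p * g)%g = map h (word p)) -> injective h -> h 1 = x ->
    h 2 = y ->
  (forall z : int, 2 < `|z| -> h z = z) ->
  (`|x| <= 2)%R -> (`|y| <= 2)%R ->
  starts_sum m b x y = (-1) ^+ (`|y| < `|x|)%N * s_var ^+ (2 - ((x < 0)%R +
    (y < x)%R))
    * t_var ^+ ((x < 0)%R + (y < x)%R) * parity_sum m b.
Proof.
move=> gP gw h_inj h1 h2 h_id x2 y2.
rewrite /starts_sum (reindex_inj (mulIg g)) /=.
rewrite (eq_bigl (fun p => parity_class b p && starts_with 1 2 (word p)));
  last first.
  move=> p; have nthE i : (i < 2)%N ->
    nth 0 (map h (word p)) i = h (nth 0 (word p) i).
    by move=> i2; rewrite (nth_map 0) // size_word (leq_trans i2).
  by rewrite gP gw /starts_with !nthE // -h1 -h2 !(inj_eq h_inj).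
(* A left inverse of [ext]; the default value occurs only outside its image. *)
pose res (p : {perm spoint m.+2}) := odflt 1%g [pick q | ext q == p].
have resK q : res (ext q) = q.
  rewrite /res; case: pickP => [r /eqP/ext_inj//|/(_ q)].
  by rewrite eqxx.
rewrite (reindex_onto (@ext m) res) /=; last first.
  by move=> p /andP[/andP[Bp _] /(ext_surj Bp)[q <-]]; rewrite resK.
rewrite mulr_sumr; apply: eq_big => [q|q _].
  by rewrite parity_class_ext ext_starts resK eqxx !andbT.
rewrite gw word_ext /= h1 h2 -map_comp -(weight_block (word_neq0 q)) //.
congr (weight [:: _, _ & _]); apply/eq_in_map => z zq /=; apply: h_id.
have z0 : z != 0 by apply: contraNneq (word_neq0 q) => <-.
by rewrite /shift_letter; case: sgrP z0 => ?; lia.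
Qed.

Lemma swap_letter_inj b : injective (swap_letter b).
Proof.
by move=> x y; rewrite /swap_letter; case: b; letter_cases x; letter_cases y; lia.
Qed.

Lemma swap_letter_big b z : 2 < `|z| -> swap_letter b z = z.
Proof. by rewrite /swap_letter; letter_cases z. Qed.

Lemma parity_sumSS m b : parity_sum m.+2 b = (s_var - t_var) ^+ 2 * parity_sum m b.
Proof.
rewrite parity_sum_starts.
rewrite (@sum_starts m b 1%g 1 2 id) //; try by move=> p; rewrite mulg1 ?map_id.
rewrite (@sum_starts m b (swap_perm false m) 2 1 (swap_letter false)) //;
  first last.
- exact: swap_letter_big.
- exact: swap_letter_inj.
- exact: word_swap_perm.
- by move=> p; apply: parity_class_swap_perm.
rewrite (@sum_starts m b (swap_perm true m) (-2) (-1) (swap_letter true)) //;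
  first last.
- exact: swap_letter_big.
- exact: swap_letter_inj.
- exact: word_swap_perm.
- by move=> p; apply: parity_class_swap_perm.
(* Composing both swaps negates ±1 and ±2, which takes 1 2 to -1 -2. *)
rewrite (@sum_starts m b (swap_perm true m * swap_perm false m)%g (-1) (-2)
  (swap_letter false \o swap_letter true)) //; first last.
- by move=> z z2; rewrite /= !swap_letter_big.
- by apply: inj_comp; apply: swap_letter_inj.
- by move=> p; rewrite mulgA !word_swap_perm -map_comp.
- by move=> p; rewrite mulgA !parity_class_swap_perm.
rewrite /= !expr0 !expr1; ring.
Qed.

(** * Rank one and the closed forms *)

Definition flip1 (c : bool) (x : spoint 1) : spoint 1 := (x.1, x.2 (+) c).

Lemma flip1K c : involutive (flip1 c).
Proof. by case=> i b; rewrite /flip1 /= -addbA addbb addbF. Qed.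

Lemma parity_sum1 b : parity_sum 1 b = if b then t_var else s_var.
Proof.
pose h c : {perm spoint 1} := perm (inv_inj (flip1K c)).
(* A permutation of the two points ±1 is determined by the sign of the image of 1; the words are 1
   and -1, of weights s and t. *)
have hE (p : {perm spoint 1}) : h (p (ord0, false)).2 = p.
  apply/permP => -[i c]; rewrite (ord1 i) permE /flip1 /=.
  have : p (ord0, true) != p (ord0, false) by rewrite (inj_eq perm_inj).
  case: c; case: (p (ord0, true)) => i1 c1; case: (p (ord0, false)) => i2 c2;
    rewrite (ord1 i1) (ord1 i2) //=.
  by case: c1; case: c2.
rewrite /parity_sum (reindex_onto h (fun p => (p (ord0, false)).2)) //=.
have hw c : word (h c) = [:: (-1) ^+ c].
  by rewrite /word enum_ordSl (size0nil (size_enum_ord 0)) /= /sentry permE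
    /spoint_val /= mulr1.
have hB c : h c \in signed_perm 1.
  by apply/signed_permP => x; rewrite !permE /flip1 /spoint_opp /= addNb.
rewrite (big_pred1 b) => [|c].
  by rewrite hw /weight; case: b; rewrite /= ?expr0 ?expr1 ?mul1r ?mulr1.
rewrite /parity_class hB negs_word hw permE /= eqxx andbT addn0.
by case: c; case: b.
Qed.

Lemma parity_sumE n b : parity_sum n b =
  if odd n then (if b then t_var else s_var) * (s_var - t_var) ^+ (n - 1)
  else if b then 0 else (s_var - t_var) ^+ n.
Proof.
have [k] := ubnP n; elim: k n => // k IHk [|[|n]] nk.
- by case: b {IHk}; rewrite -?SgnBDesD_parity -?SgnBDesBD_parity ?SgnBDesD0
  ?SgnBDesBD0.
- by rewrite parity_sum1 /= expr0 mulr1.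
rewrite parity_sumSS IHk; last by lia.
rewrite /= negbK; case: ifP => [odd_n|_].
  (* Since [n] is odd, it is positive and the subtraction in [n - 1] is not truncated. *)
  rewrite mulrCA -exprD; congr (_ * _ ^+ _); case: n odd_n {nk} => //; lia.
by case: b {IHk}; rewrite ?mulr0 // -exprD.
Qed.

Unset Implicit Arguments.

Theorem theorem5p10 (n : nat) (hn : (2 <= n)%N) :
  [/\ SgnBDesD n = (s_var - t_var) ^+ 2 * SgnBDesD (n - 2),
      SgnBDesBD n = (s_var - t_var) ^+ 2 * SgnBDesBD (n - 2),
      SgnBDesD n =
        (if odd n then s_var * (s_var - t_var) ^+ (n - 1)
         else (s_var - t_var) ^+ n)
    & SgnBDesBD n =
        (if odd n then t_var * (s_var - t_var) ^+ (n - 1) else 0)].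
Proof.
rewrite !SgnBDesD_parity !SgnBDesBD_parity; split; try exact: parity_sumE.
  by case: n hn => [|[|n]] // _; rewrite subSS subSS subn0 parity_sumSS.
by case: n hn => [|[|n]] // _; rewrite subSS subSS subn0 parity_sumSS.
Qed.
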